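(* Let $Z_1=V_2/V_1$ and, for $u>0$, define $$\phi_1^{01}(u)=\frac{1}{b-a+1}\,\frac{\int_0^1 y^{b_2-a_2-1}(yu+1)^{-(b-a+1)}dy}{\int_0^1 y^{b_2-a_2-1}(yu+1)^{-(b-a+2)}dy},\qquad \phi_1^{02}(u)=\frac{1}{b-a}\,\frac{\int_0^1 y^{b_2-a_2-1}(yu+1)^{-(b-a)}dy}{\int_0^1 y^{b_2-a_2-1}(yu+1)^{-(b-a+1)}dy},$$ $$\phi_1^{03}(u)=\left(\frac{1}{(b-a-1)(b-a)}\,\frac{\int_0^1 y^{b_2-a_2-1}(yu+1)^{-(b-a-1)}dy}{\int_0^1 y^{b_2-a_2-1}(yu+1)^{-(b-a+1)}dy}\right)^{1/2}.$$ Then the estimators $\delta_{\phi_1^{01}}=\phi_1^{01}(Z_1)V_1$, $\delta_{\phi_1^{02}}=\phi_1^{02}(Z_1)V_1$ and $\delta_{\phi_1^{03}}=\phi_1^{03}(Z_1)V_1$ are generalized Bayes estimators of $\sigma_1$ for the loss functions $L_1(\delta/\sigma_1)$, $L_2(\delta/\sigma_1)$ and $L_3(\delta/\sigma_1)$ respectively, where $L_1(t)=(t-1)^2$, $L_2(t)=t-\ln t-1$, $L_3(t)=t+\frac1t-2$, with respect to the improper prior $$\Pi(\theta)=\frac{1}{\sigma_1\sigma_2},\qquad \mu_1<X_{a_1},\ \mu_2<X_{a_2},\ \sigma_1,\sigma_2>0,\ \sigma_1\le\sigma_2.$$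
   Context: Fix integers $1\le a_i<b_i\le n_i$, $i=1,2$, and put $a=a_1+a_2$, $b=b_1+b_2$. The unknown parameter is $\theta=(\mu_1,\mu_2,\sigma_1,\sigma_2)$ with $\mu_1,\mu_2\in\mathbb{R}$ and $0<\sigma_1\le\sigma_2$. From a random sample of size $n_i$ from the exponential distribution with density $\sigma_i^{-1}e^{-(x-\mu_i)/\sigma_i}$, $x>\mu_i$, one observes only the order statistics of ranks $a_i,\dots,b_i$ (doubly type-II censored sample). A complete sufficient statistic is $(X_{a_1},X_{a_2},V_1,V_2)$, consisting of four independent random variables, where $X_{a_i}$ has density $$\frac{n_i!}{(a_i-1)!(n_i-a_i)!}\Big[1-e^{-\frac{x-\mu_i}{\sigma_i}}\Big]^{a_i-1}\frac1{\sigma_i}\Big[e^{-\frac{x-\mu_i}{\sigma_i}}\Big]^{n_i-a_i+1},\quad x>\mu_i,$$ and $V_i$ has the gamma distribution with shape $b_i-a_i$ and scale $\sigma_i$. A generalized Bayes estimator of $\sigma_1$ with respect to an improper prior and loss $L(\delta/\sigma_1)$ is one that, for each observed data value, minimizes over $\delta>0$ the posterior expected loss, the posterior being the normalized product of the prior density and the likelihood (the joint density of $(X_{a_1},X_{a_2},V_1,V_2)$). *)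

(* Defs.v *)
From HB Require Import structures.
From mathcomp Require Import all_boot all_order all_algebra.
From mathcomp Require Import all_classical all_reals all_analysis.
From mathcomp Require Import measurable_realfun.
Set Implicit Arguments.
Unset Strict Implicit.
Unset Printing Implicit Defensive.
Import Order.TTheory GRing.Theory Num.Theory.
Import numFieldNormedType.Exports.
Local Open Scope classical_set_scope.
Local Open Scope ring_scope.

Notation plane R := (measurableTypeR R * measurableTypeR R)%type.

(* Lebesgue measure on the plane, packaged so that its sigma-finiteness is
   found by unification and the product can be iterated. *)
Section lebesgue2.
Context (R : realType).

Definition lebesgue2 : set (plane R) -> \bar R :=
  (@lebesgue_measure R \x @lebesgue_measure R)%E.

HB.instance Definition _ := Measure.on lebesgue2.

Let lebesgue2_sigma_finite : sigma_finite setT lebesgue2.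
Proof.
have /sigma_finiteP[F [TF ndF Foo]] := sigma_finiteT (@lebesgue_measure R).
exists (fun n => F n `*` F n).
  rewrite -setXTT TF predeqE => -[x y]; split.
    move=> [/= [n _ Fnx] [k _ Fky]]; exists (maxn n k) => //; split.
    - by move: x Fnx; exact/subsetPset/ndF/leq_maxl.
    - by move: y Fky; exact/subsetPset/ndF/leq_maxr.
  by move=> [n _ []/= ? ?]; split; exists n.
move=> k; have [? ?] := Foo k.
split; first exact: measurableX.
by rewrite /lebesgue2 product_measure1E// lte_mul_pinfty// ge0_fin_numE.
Qed.

HB.instance Definition _ :=
  Measure_isSigmaFinite.Build _ _ _ lebesgue2 lebesgue2_sigma_finite.

End lebesgue2.

(* theta = ((mu_1, mu_2), (sigma_1, sigma_2)); the constraint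
   0 < sigma_1 <= sigma_2 is carried by the prior density, which vanishes
   elsewhere. *)
Notation param R := (plane R * plane R)%type.
Definition location1 (R : realType) (th : param R) : R := th.1.1.
Definition location2 (R : realType) (th : param R) : R := th.1.2.
Definition scale1 (R : realType) (th : param R) : R := th.2.1.
Definition scale2 (R : realType) (th : param R) : R := th.2.2.

Definition lebesgue4 (R : realType) : {measure set (param R) -> \bar R} :=
  (@lebesgue2 R \x @lebesgue2 R)%E.

(* (x_1, x_2, v_1, v_2), a value of (X_{a_1}, X_{a_2}, V_1, V_2) *)
Definition data (R : realType) := (R * R * R * R)%type.
Definition X1 (R : realType) (x : data R) : R := x.1.1.1.
Definition X2 (R : realType) (x : data R) : R := x.1.1.2.
Definition V1 (R : realType) (x : data R) : R := x.1.2.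
Definition V2 (R : realType) (x : data R) : R := x.2.
Definition Z1 (R : realType) (x : data R) : R := V2 x / V1 x.

(* Density of the order statistic of rank a in a sample of size n. *)
Definition orderstat_pdf (R : realType) (n a : nat) (mu sigma x : R) : R :=
  if mu < x then
    n`!%:R / (a.-1`!%:R * (n - a)`!%:R)
    * (1 - expR (- ((x - mu) / sigma))) ^+ a.-1
    * sigma^-1
    * expR (- ((x - mu) / sigma)) ^+ (n - a + 1)
  else 0.

(* Only integer shapes k >= 1 occur, so that Gamma(k) = (k - 1)!. *)
Definition gamma_pdf (R : realType) (k : nat) (sigma v : R) : R :=
  if 0 < v then v ^+ k.-1 * expR (- (v / sigma)) / (k.-1`!%:R * sigma ^+ k)
  else 0.

(* Joint density of the four independent components of the data. *)
Definition likelihood (R : realType) (n1 a1 b1 n2 a2 b2 : nat)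
    (x : data R) (th : param R) : R :=
  orderstat_pdf n1 a1 (location1 th) (scale1 th) (X1 x)
  * orderstat_pdf n2 a2 (location2 th) (scale2 th) (X2 x)
  * gamma_pdf (b1 - a1) (scale1 th) (V1 x)
  * gamma_pdf (b2 - a2) (scale2 th) (V2 x).

(* The restriction mu_i < x_i makes the domain depend on the data, but it is
   harmless: the likelihood is 0 when it fails. *)
Definition prior (R : realType) (x : data R) (th : param R) : R :=
  if [&& location1 th < X1 x, location2 th < X2 x,
         0 < scale1 th, 0 < scale2 th & scale1 th <= scale2 th]
  then (scale1 th * scale2 th)^-1 else 0.

Section generalized_Bayes.
Context (R : realType) (prior lik : data R -> param R -> R) (L : R -> R).

Definition marginal (x : data R) : \bar R :=
  (\int[@lebesgue4 R]_th (prior x th * lik x th)%:E)%E.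

Definition posterior (x : data R) (th : param R) : R :=
  prior x th * lik x th / fine (marginal x).

(* Posterior expected loss of the action d when sigma_1 is estimated. *)
Definition posterior_risk (x : data R) (d : R) : \bar R :=
  (\int[@lebesgue4 R]_th (L (d / scale1 th) * posterior x th)%:E)%E.

(* The first two conditions say that the (improper) prior has a genuine
   posterior; finiteness of the attained risk excludes the degenerate case in
   which every action would be a minimizer. *)
Definition generalized_Bayes (delta : data R -> R) : Prop :=
  forall x : data R, 0 < V1 x -> 0 < V2 x ->
    [/\ (0 < marginal x)%E, (marginal x < +oo)%E,
        0 < delta x, (posterior_risk x (delta x) < +oo)%E &
        forall d : R, 0 < d ->
          (posterior_risk x (delta x) <= posterior_risk x d)%E].

End generalized_Bayes.

Definition loss1 (R : realType) (t : R) : R := (t - 1) ^+ 2.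
Definition loss2 (R : realType) (t : R) : R := t - ln t - 1.
Definition loss3 (R : realType) (t : R) : R := t + t^-1 - 2.

(* \int_0^1 y^(m - 1) (y u + 1)^(- k) dy *)
Definition ratio_int (R : realType) (m k : nat) (u : R) : R :=
  \int[@lebesgue_measure R]_(y in `[0, 1]) (y ^+ (m - 1) * (y * u + 1) ^- k).

Section estimators.
Context (R : realType) (a1 b1 a2 b2 : nat).
Let a := (a1 + a2)%N.
Let b := (b1 + b2)%N.

Definition phi01 (u : R) : R :=
  (b - a + 1)%:R^-1
  * (ratio_int (b2 - a2) (b - a + 1) u / ratio_int (b2 - a2) (b - a + 2) u).

Definition phi02 (u : R) : R :=
  (b - a)%:R^-1
  * (ratio_int (b2 - a2) (b - a) u / ratio_int (b2 - a2) (b - a + 1) u).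

Definition phi03 (u : R) : R :=
  Num.sqrt (((b - a - 1) * (b - a))%:R^-1
    * (ratio_int (b2 - a2) (b - a - 1) u
       / ratio_int (b2 - a2) (b - a + 1) u)).

End estimators.

(* Main.v *)
(* The order-statistic densities have integral over mu_i independent of
   sigma_i, so the locations integrate out.  In the remaining integral over
   (sigma_1, sigma_2), put y = sigma_1 / sigma_2 and integrate sigma_1 first:
   an inverse gamma integral.  Hence E[sigma_1^-j | data] is, up to a constant
   free of j,
     (N + j - 1)! v_1^-(N + j) \int_0^1 y^(q - 1) (y u + 1)^-(N + j) dy
   with q = b_2 - a_2, N = b - a and u = v_2 / v_1.  For every loss and all
   actions d, D, the difference L(d / sigma_1) - L(D / sigma_1) is a combination
   of sigma_1^-j, -1 <= j <= 2; its expectation is thus explicit, and it is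
   nonnegative when D is the announced estimator.
   The risk for L_2, itself not such a combination, is finite because
   0 <= L_2(t) <= t + 1 / t. *)

Require Import Defs.
From HB Require Import structures.
From mathcomp Require Import all_boot all_order all_algebra.
From mathcomp Require Import all_classical all_reals all_analysis.
From mathcomp Require Import measurable_realfun ring lra.
Set Implicit Arguments.
Unset Strict Implicit.
Unset Printing Implicit Defensive.
Import Order.TTheory GRing.Theory Num.Theory.
Import numFieldNormedType.Exports.
Local Open Scope classical_set_scope.
Local Open Scope ring_scope.

(** * Improper integrals and substitution *)

(** Nothing is assumed of [f] and [F] at 0 beyond a right limit of [F], so the half-line is
    exhausted by [[e n, +oo[] with [e n = 1 / (n + 1)]. Monotone convergence and the limit of
    [F (e n)] give two limits of the same sequence. *)
Lemma ge0_FTC2_0y (R : realType) (f F : R -> R) (l0 l : R) :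
  (forall x : R, 0 < x -> 0 <= f x) ->
  (forall x : R, 0 < x -> {for x, continuous f}) ->
  (forall x : R, 0 < x -> is_derive x 1 F (f x)) ->
  F x @[x --> 0^'+] --> l0 -> F x @[x --> +oo] --> l ->
  (\int[lebesgue_measure]_(x in `]0%R, +oo[) (f x)%:E = (l - l0)%:E)%E.
Proof.
move=> f0 cf dF F0 Fy.
pose e n : R := n.+1%:R^-1.
have e0 n : 0 < e n by rewrite invr_gt0.
have cF x : 0 < x -> {for x, continuous F}.
  by move=> x0; apply/differentiable_continuous/derivable1_diffP; have [] := dF x x0.
have intn n : (\int[lebesgue_measure]_(x in `[e n, +oo[) (f x)%:E = (l - F (e n))%:E)%E.
  rewrite (@ge0_continuous_FTC2y _ _ F _ l)//.
  - by move=> x ex; apply: f0; exact: lt_le_trans ex.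
  - apply/continuous_within_itvcyP; split.
      by move=> x; rewrite in_itv/= andbT => ex; apply: cf; exact: lt_trans ex.
    by apply/cvg_at_right_filter/cf.
  - by move=> x ex; have [] := dF x (lt_trans (e0 n) ex).
  - by apply/cvg_at_right_filter/cF.
  - move=> x; rewrite in_itv/= andbT => ex.
    by rewrite derive1E; have [_ ->] := dF x (lt_trans (e0 n) ex).
have Ue : `]0%R, +oo[%classic = \bigcup_n `[e n, +oo[%classic :> set R.
  apply/seteqP; split => x /=; rewrite in_itv/= andbT.
    move=> x0; have [n nx] := ltr_add_invr x0.
    exists n => //=; rewrite in_itv/= andbT.
    by move: nx; rewrite add0r => /ltW.
  by case=> n _ /=; rewrite in_itv/= andbT; apply: lt_le_trans.
rewrite Ue.
have mf : measurable_fun (\bigcup_n `[e n, +oo[%classic) (fun x => (f x)%:E).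
  rewrite -Ue; apply/measurable_EFinP.
  apply: open_continuous_measurable_fun; first exact: interval_open.
  by move=> x; rewrite inE/= in_itv/= andbT => /cf.
have lim1 : (\int[lebesgue_measure]_(x in `[e n, +oo[) (f x)%:E)%E @[n --> \oo] -->
    (\int[lebesgue_measure]_(x in \bigcup_n `[e n, +oo[%classic) (f x)%:E)%E.
  apply: ge0_nondecreasing_set_cvg_integral => //.
  - apply/nondecreasing_seqP => n; apply/subsetPset => x /=.
    rewrite !in_itv/= !andbT; apply: le_trans.
    by rewrite lef_pV2 ?posrE// ler_nat.
  - move=> n; apply: measurable_funS mf.
      exact: bigcupT_measurable.
    by move=> x ?; exists n.
  - move=> n x /=; rewrite in_itv/= andbT => ex; rewrite lee_fin.
    by apply: f0; exact: lt_le_trans ex.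
have lim2 : (\int[lebesgue_measure]_(x in `[e n, +oo[) (f x)%:E)%E @[n --> \oo] -->
    (l - l0)%:E.
  under eq_fun do rewrite intn.
  apply: cvg_EFin; first exact: nearW.
  apply: cvgB; first exact: cvg_cst.
  have := (cvg_at_rightP F 0 l0).1 F0 e; apply; split => //.
  exact: cvg_harmonic.
exact: (cvg_unique _ lim1 lim2).
Qed.

Lemma cvgy_invr (R : realType) : y^-1 @[y --> +oo%R] --> (0 : R).
Proof. by apply/gtr0_cvgV0; [exact: nbhs_pinfty_gt|exact: cvg_id]. Qed.

Lemma is_derive_exprn (R : realType) (n : nat) (x : R) :
  is_derive x 1 (fun y : R => y ^+ n) (n%:R * x ^+ n.-1).
Proof.
have := is_deriveX n (is_derive_id x (1 : R)).
by rewrite exprfctE /GRing.scale/= mulr1.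
Qed.

(** The exponential series bounds [expR (c * y)] below by its term of degree [k + 1], so the product
    is at most [C / y]. *)
Lemma cvgy_exprn_expRN (R : realType) (c : R) (k : nat) : 0 < c ->
  y ^+ k * expR (- (c * y)) @[y --> +oo%R] --> (0 : R).
Proof.
move=> c0.
pose C : R := k.+1`!%:R / c ^+ k.+1.
have Cy : C * y^-1 @[y --> +oo%R] --> (0 : R).
  rewrite -[X in _ --> X](mulr0 C); apply: cvgM; first exact: cvg_cst.
  exact: cvgy_invr.
apply: (@squeeze_cvgr _ _ _ _ (cst 0) (fun y : R => C * y^-1)); last 2 first.
- exact: cvg_cst.
- exact: Cy.
near=> y.
have y0 : 0 < y by near: y; exact: nbhs_pinfty_gt.
rewrite mulr_ge0 ?expR_ge0 ?exprn_ge0 ?(ltW y0)//=.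
rewrite expRN ler_pdivrMr ?expR_gt0// mulrAC ler_pdivlMr// -exprSr.
have -> : y ^+ k.+1 = C * ((c * y) ^+ k.+1 / k.+1`!%:R).
  by rewrite /C exprMn; field;
    rewrite gt_eqF ?pnatr_eq0 -?lt0n ?fact_gt0// ?expf_neq0 ?gt_eqF.
rewrite ler_wpM2l ?divr_ge0 ?exprn_ge0 ?ler0n ?(ltW c0)//.
apply: le_trans (expR_ge1Dxn k (ltW (mulr_gt0 c0 y0))).
by rewrite lerDr ler01.
Unshelve. all: by end_near. Qed.


(** [g] is the upper incomplete gamma integral of [t ^+ k * expR (- (c * t))] from [y] to infinity.
    The induction step is the recursion obtained by integrating by parts. *)
Lemma exprn_expRN_antiderivative (R : realType) (c : R) (k : nat) : 0 < c ->
  exists g : R -> R, [/\ forall y : R, is_derive y 1 g (- (y ^+ k * expR (- (c * y)))),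
    g 0 = k`!%:R / c ^+ k.+1 & g y @[y --> +oo%R] --> (0 : R)].
Proof.
move=> c0; elim: k => [|k [g [dg g0 gy]]].
  exists (fun y => expR (- (c * y)) / c); split.
  - move=> y; apply: is_derive_eq; rewrite expr0 mul1r scaler0 add0r.
    by rewrite /GRing.scale/=; field; rewrite gt_eqF.
  - by rewrite mulr0 oppr0 expR0 fact0 expr1.
  - rewrite -[X in _ --> X](mul0r c^-1); apply: cvgM; last exact: cvg_cst.
    apply: cvg_trans (cvgy_exprn_expRN 0 c0).
    by apply: near_eq_cvg; near=> y; rewrite expr0 mul1r.
exists (fun y => k.+1%:R / c * g y + y ^+ k.+1 * expR (- (c * y)) / c); split.
- move=> y; have dX := is_derive_exprn k.+1 y.
  apply: is_derive_eq.
  rewrite /GRing.scale/=.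
  by field; rewrite gt_eqF.
- rewrite g0 mulr0 oppr0 expR0 expr0n/= !mul0r addr0 factS natrM.
  by rewrite [in RHS]exprS invfM mulrACA.
- rewrite -[X in _ --> X](mulr0 (k.+1%:R / c)) -[X in _ --> X]addr0.
  apply: cvgD; first by apply: cvgM; [exact: cvg_cst|].
  rewrite -[X in _ --> X](mul0r c^-1); apply: cvgM; last exact: cvg_cst.
  exact: cvgy_exprn_expRN.
Unshelve. all: by end_near. Qed.


(** Under [y = 1 / x] this is a gamma integral; two of the [k + 2] inverse powers are the Jacobian.
    The antiderivative [g (1 / x)] tends to 0 at [0^'+] and to [g 0] at infinity. *)
Lemma invgamma_integral (R : realType) (c : R) (k : nat) : 0 < c ->
  (\int[lebesgue_measure]_(x in `]0%R, +oo[)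
     (x^-1 ^+ k.+2 * expR (- (c / x)))%:E = (k`!%:R / c ^+ k.+1)%:E)%E.
Proof.
move=> c0; have [g [dg g0 gy]] := exprn_expRN_antiderivative k c0.
rewrite -[X in _ = X%:E]subr0; apply: (@ge0_FTC2_0y _ _ (g \o GRing.inv)).
- by move=> x x0; rewrite mulr_ge0 ?expR_ge0// exprn_ge0// invr_ge0 ltW.
- move=> x x0; have cV : {for x, continuous (@GRing.inv R)}.
    by apply: inv_continuous; rewrite gt_eqF.
  apply: continuousM.
    apply: (@continuous_comp R R R GRing.inv (fun z : R => z ^+ k.+2)) => //.
    exact: exprn_continuous.
  apply: (@continuous_comp R R R (fun z : R => - (c / z)) expR).
    by apply: continuousN; apply: continuousM => //; exact: cst_continuous.
  exact: continuous_expR.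
- move=> x x0; have dV : is_derive x 1 GRing.inv (- x ^- 2 *: (1 : R)).
    by apply: is_deriveV; rewrite gt_eqF.
  have dgx := dg x^-1.
  apply: is_derive_eq; rewrite /GRing.scale/= -exprVn.
  by move: (x^-1) (expR _) => u E; rewrite !exprS; ring.
- apply: (@cvg_comp _ _ _ (@GRing.inv R) g _ _ _ _ gy).
  apply/gtr0_cvgV0 => /=.
    by near=> x; rewrite invr_gt0; near: x; exact: nbhs_right_gt.
  rewrite [X in X x @[x --> _] --> _](_ : _ = id); last first.
    by apply/funext => x; exact: invrK.
  exact: cvg_at_right_filter cvg_id.
- rewrite -g0; apply: (@cvg_comp _ _ _ (@GRing.inv R) g _ (nbhs (0 : R))).
    exact: cvgy_invr.
  have : {for (0 : R), continuous g}.
    by apply/differentiable_continuous/derivable1_diffP; have [] := dg 0.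
  exact.
Unshelve. all: by end_near. Qed.

Lemma continuous_antiderivative01 (R : realType) (h : R -> R) : continuous h ->
  exists P : R -> R, (forall y : R, 0 <= y <= 1 -> is_derive y 1 P (h y)) /\
    (\int[lebesgue_measure]_(y in `[0%R, 1%R]) (h y)%:E = (P 1 - P 0)%:E)%E.
Proof.
(* Starting at -1, inside the larger interval [[-1, 2]], puts 0 and 1 in the interior. [P] is then
   differentiable from both sides at these endpoints, and so can be composed with a map reaching
   them. *)
move=> ch; pose P (y : R) := \int[lebesgue_measure]_(t in `[- 1%R, y]) h t.
have dP (y : R) : 0 <= y <= 1 -> is_derive y 1 P (h y).
  move=> /andP[y0 y1].
  have intg : lebesgue_measure.-integrable `[-1%R, 2%R] (EFin \o h).
    apply: continuous_compact_integrable; first exact: segment_compact.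
    exact: continuous_subspaceT.
  have y2 : y < 2 by rewrite (le_lt_trans y1)// ltr1n.
  have [dP Pd] := continuous_FTC1_closed y2 intg (lt_le_trans (ltrN10 _) y0) (ch y).
  by split; [exact: dP|rewrite -derive1E].
have cP (y : R) : 0 <= y <= 1 -> {for y, continuous P}.
  by move=> /dP[dPy _]; apply/differentiable_continuous/derivable1_diffP.
exists P; split => //; rewrite EFinB; apply: continuous_FTC2.
- exact: ltr01.
- exact: continuous_subspaceT.
- split.
  + by move=> y; rewrite in_itv/= => /andP[/ltW y0 /ltW y1]; have [] := dP y _; rewrite ?y0.
  + by apply/cvg_at_right_filter/cP; rewrite lexx ler01.
  + by apply/cvg_at_left_filter/cP; rewrite lexx ler01.
- move=> y; rewrite in_itv/= => /andP[/ltW y0 /ltW y1]; rewrite derive1E.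
  by have [] := dP y _; rewrite ?y0.
Qed.

(** By the mean value theorem the integral equals [h c] for some [c] strictly between 0 and 1. *)
Lemma continuous_integral01_gt0 (R : realType) (h : R -> R) : continuous h ->
  (forall y : R, 0 < y < 1 -> 0 < h y) ->
  (0 < \int[lebesgue_measure]_(y in `[0%R, 1%R]) (h y)%:E < +oo)%E.
Proof.
move=> ch h0; have [P [dP ->]] := continuous_antiderivative01 ch.
rewrite ltry andbT lte_fin.
have [|||c] := @MVT R P h 0 1; rewrite ?ltr01//.
- by move=> y; rewrite in_itv/= => /andP[/ltW y0 /ltW y1]; apply: dP; rewrite y0.
- apply: derivable_within_continuous => y; rewrite in_itv/= => /dP[dPy _].
  exact: dPy.
- by rewrite in_itv/= => /h0 hc ->; rewrite subr0 mulr1.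
Qed.

(** With [P] an antiderivative of [h], [- P (psi z)] is one of the left integrand; it runs from
    [- P 1] at [a] to [- P 0] at infinity. Both substitutions used later, [psi] exponential and
    [psi z = s / z], have this shape. *)
Lemma decreasing_integration_by_substitution01 (R : realType)
    (h psi dpsi : R -> R) (a : R) : continuous h ->
  (forall y : R, 0 <= y <= 1 -> 0 <= h y) ->
  psi a = 1 -> psi z @[z --> +oo%R] --> (0 : R) ->
  (forall z : R, a <= z -> 0 < psi z <= 1) ->
  (forall z : R, a <= z -> 0 <= dpsi z) ->
  (forall z : R, a <= z -> {for z, continuous dpsi}) ->
  (forall z : R, a <= z -> is_derive z 1 psi (- dpsi z)) ->
  (\int[lebesgue_measure]_(z in `[a, +oo[) (h (psi z) * dpsi z)%:E =
   \int[lebesgue_measure]_(y in `[0%R, 1%R]) (h y)%:E)%E.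
Proof.
move=> ch h0 psia psi0 psi01 dpsi0 cdpsi dpsiP.
have [P [dP ->]] := continuous_antiderivative01 ch.
have psi01' z : a <= z -> 0 <= psi z <= 1 by move=> /psi01/andP[/ltW -> ->].
have dF z : a <= z -> is_derive z 1 (fun z : R => - P (psi z)) (h (psi z) * dpsi z).
  move=> az; have dpsiz := dpsiP z az; have dPz := dP _ (psi01' z az).
  by apply: is_derive_eq; rewrite /GRing.scale/= mulrN opprK.
have cF z : a <= z -> {for z, continuous (fun z : R => - P (psi z))}.
  by move=> /dF[dFz _]; apply/differentiable_continuous/derivable1_diffP.
have cf z : a <= z -> {for z, continuous (fun z : R => h (psi z) * dpsi z)}.
  move=> az; apply: continuousM; last exact: cdpsi.
  apply: (@continuous_comp R R R psi h); last exact: ch.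
  by have [dpsiz _] := dpsiP z az; apply/differentiable_continuous/derivable1_diffP.
transitivity ((- P 0)%:E - (- P (psi a))%:E)%E.
  apply: (@ge0_continuous_FTC2y _ _ (fun z : R => - P (psi z))).
  - by move=> z az; rewrite mulr_ge0 ?h0 ?dpsi0// psi01'.
  - apply/continuous_within_itvcyP; split.
      by move=> z; rewrite in_itv/= andbT => /ltW/cf.
    exact/cvg_at_right_filter/cf.
  - apply: cvgN; apply: (@cvg_comp _ _ _ psi P _ (nbhs (0 : R))); first exact: psi0.
    have dP0 : is_derive (0 : R) 1 P (h 0) by apply: dP; rewrite lexx ler01.
    have : {for (0 : R), continuous P}.
      by apply/differentiable_continuous/derivable1_diffP; case: dP0.
    exact.
  - by move=> z /ltW/dF[].
  - exact/cvg_at_right_filter/cF.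
  - by move=> z; rewrite in_itv/= andbT => /ltW/dF[_ <-]; rewrite derive1E.
by rewrite psia -EFinB opprK addrC.
Qed.

(** This is [y = sigma_1 / sigma_2] at fixed [s = sigma_1], with [z] for sigma_2: the constraint
    [s <= z] becomes [y <= 1]. *)
Lemma integration_by_substitution_invr (R : realType) (h : R -> R) (s : R) :
  0 < s -> continuous h -> (forall y : R, 0 <= y <= 1 -> 0 <= h y) ->
  (\int[lebesgue_measure]_(z in `[s, +oo[) (h (s / z) * (s * z^-1 ^+ 2))%:E =
   \int[lebesgue_measure]_(y in `[0%R, 1%R]) (h y)%:E)%E.
Proof.
move=> s0 ch h0.
apply: (@decreasing_integration_by_substitution01 _ _ (fun z : R => s / z)) => //.
- by rewrite divff ?gt_eqF.
- rewrite -[X in _ --> X](mulr0 s); apply: cvgM; first exact: cvg_cst.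
  exact: cvgy_invr.
- move=> z sz; have z0 := lt_le_trans s0 sz.
  by rewrite divr_gt0// ler_pdivrMr// mul1r.
- move=> z sz; have z0 := lt_le_trans s0 sz.
  by rewrite mulr_ge0 ?(ltW s0)// exprn_ge0// invr_ge0 ltW.
- move=> z sz; have z0 := lt_le_trans s0 sz.
  apply: continuousM; first exact: cst_continuous.
  apply: (@continuous_comp R R R GRing.inv (fun z : R => z ^+ 2)).
    by apply: inv_continuous; rewrite gt_eqF.
  exact: exprn_continuous.
- move=> z sz; have z0 := lt_le_trans s0 sz.
  have dV : is_derive z 1 GRing.inv (- z ^- 2 *: (1 : R)).
    by apply: is_deriveV; rewrite gt_eqF.
  apply: is_derive_eq; rewrite /GRing.scale/= exprVn.
  by ring.
Qed.

(** * Integration of the likelihood *)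

(** Put [y = expR (- ((x - mu) / sigma))]: one factor [y] and [sigma^-1] form the Jacobian, and what
    remains is the beta integrand [h y] on [[0, 1]], free of [sigma] and [x]. Only the sign of [K]
    is recorded, as it cancels in the posterior. *)
Lemma orderstat_pdf_integral (R : realType) (n a : nat) : exists2 K : R, 0 < K &
  forall sigma x : R, 0 < sigma ->
    (\int[lebesgue_measure]_mu (orderstat_pdf n a mu sigma x)%:E = K%:E)%E.
Proof.
pose C : R := n`!%:R / (a.-1`!%:R * (n - a)`!%:R).
have C0 : 0 < C by rewrite divr_gt0 ?mulr_gt0// ltr0n fact_gt0.
pose h (y : R) := C * (1 - y) ^+ a.-1 * y ^+ (n - a).
have ch (y : R) : {for y, continuous h}.
  apply: continuousM; last exact: exprn_continuous.
  apply: continuousM; first exact: cst_continuous.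
  apply: (@continuous_comp R R R (fun y : R => 1 - y) (fun y : R => y ^+ a.-1)).
    by apply: continuousB; [exact: cst_continuous|exact: cvg_id].
  exact: exprn_continuous.
have h0 (y : R) : 0 <= y <= 1 -> 0 <= h y.
  by move=> /andP[y0 y1]; rewrite !mulr_ge0 ?(ltW C0)// exprn_ge0// subr_ge0.
have /andP[I0 Ioo] : (0 < \int[lebesgue_measure]_(y in `[0%R, 1%R]) (h y)%:E < +oo)%E.
  apply: continuous_integral01_gt0 => // y /andP[y0 y1].
  by rewrite !mulr_gt0 ?exprn_gt0// subr_gt0.
exists (fine (\int[lebesgue_measure]_(y in `[0%R, 1%R]) (h y)%:E)).
  by rewrite fine_gt0// I0.
move=> sigma x s0; rewrite fineK; last by rewrite ge0_fin_numE// ltW.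
pose psi z := expR (- ((x - z) / sigma)).
pose G z := h (psi z) * (psi z / sigma).
have cpsi (z : R) : {for z, continuous psi}.
  apply: (@continuous_comp R R R (fun z => - ((x - z) / sigma)) expR).
    apply: continuousN; apply: continuousM; last exact: cst_continuous.
    by apply: continuousB; [exact: cst_continuous|exact: cvg_id].
  exact: continuous_expR.
have cG (z : R) : {for z, continuous G}.
  apply: continuousM.
    by apply: (@continuous_comp R R R psi h); [exact: cpsi|exact: ch].
  by apply: continuousM; [exact: cpsi|exact: cst_continuous].
have psi1 z : z <= x -> 0 < psi z <= 1.
  move=> zx; rewrite expR_gt0 -expR0 ler_expR oppr_le0.
  by rewrite divr_ge0 ?subr_ge0// ltW.
have G0 z : z <= x -> 0 <= G z.
  move=> /psi1/andP[p0 p1].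
  by rewrite mulr_ge0 ?h0 ?(ltW p0)// divr_ge0 ?(ltW p0)// ltW.
transitivity (\int[lebesgue_measure]_(z in `]-oo, x[) (G z)%:E)%E.
  rewrite [RHS]integral_mkcond; apply: eq_integral => z _.
  rewrite patchE /orderstat_pdf mem_setE in_itv/=; case: ifPn => // zx.
  by rewrite /G /h /psi -/C addn1 exprS; congr EFin; ring.
rewrite integral_itv_bndo_bndc; last first.
  by apply/measurable_EFinP/measurable_funTS; exact: continuous_measurable_fun.
(* The reflection [z -> - z] turns the domain into [[- x, +oo[], on which [psi (- z)] decreases from
   1 to 0. *)
rewrite -[x in `]-oo, x]](opprK x) ge0_integration_by_substitutionNy.
- apply: (@decreasing_integration_by_substitution01 _ h (psi \o -%R)
    (fun z => psi (- z) / sigma)) => //.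
  + by rewrite /psi/= opprK subrr mul0r oppr0 expR0.
  + apply: (@cvg_comp _ _ _ (fun z => (x - - z) / sigma) (fun w => expR (- w)) _
      (pinfty_nbhs R)); last exact: cvgr_expR.
    apply/cvgryPge => A; near=> z.
    rewrite ler_pdivlMr// opprK -lerBlDl; near: z.
    by apply: nbhs_pinfty_ge; rewrite num_real.
  + move=> z; rewrite lerNl; exact: psi1.
  + by move=> z; rewrite lerNl => /psi1/andP[p0 _]; rewrite divr_ge0 ?(ltW p0)// ltW.
  + move=> z _; apply: continuousM; last exact: cst_continuous.
    apply: (@continuous_comp R R R -%R psi); last exact: cpsi.
    by apply: continuousN; exact: cvg_id.
  + move=> z _; apply: is_derive_eq.
    by rewrite /GRing.scale/= /psi; ring.
- exact: continuous_subspaceT.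
- by move=> z; rewrite opprK in_itv/= => /ltW/G0.
Unshelve. all: by end_near. Qed.

(** * Measurability of the densities and of the prior *)

Lemma measurable_fun_invr d (T : measurableType d) (R : realType) (D : set T)
    (f : T -> R) :
  measurable_fun D f -> measurable_fun D (fun x => (f x)^-1).
Proof.
(* Inversion is discontinuous at 0, so it is expressed through real powers, which are measurable. At
   [f x = 0] both sides are 0 by the convention [0^-1 = 0]. *)
move=> mf; have -> : (fun x => (f x)^-1) = (fun x => f x * ((f x ^+ 2) `^ (-1))).
  apply/funext => x; rewrite powR_inv1 ?sqr_ge0//.
  have [->|fx0] := eqVneq (f x) 0; first by rewrite invr0 mul0r.
  by rewrite expr2 invfM mulVKf.
apply: measurable_funM => //.
exact: (measurableT_comp (measurable_powR (-1 : R)) (measurable_funX 2 mf)).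
Qed.

Lemma measurable_fun_expR d (T : measurableType d) (R : realType) (D : set T)
    (f : T -> R) :
  measurable_fun D f -> measurable_fun D (fun x => expR (f x)).
Proof. exact: measurableT_comp. Qed.

Lemma measurable_location1 (R : realType) : measurable_fun setT (@location1 R).
Proof. exact: (measurableT_comp measurable_fst measurable_fst). Qed.

Lemma measurable_location2 (R : realType) : measurable_fun setT (@location2 R).
Proof. exact: (measurableT_comp measurable_snd measurable_fst). Qed.

Lemma measurable_scale1 (R : realType) : measurable_fun setT (@scale1 R).
Proof. exact: (measurableT_comp measurable_fst measurable_snd). Qed.

Lemma measurable_scale2 (R : realType) : measurable_fun setT (@scale2 R).
Proof. exact: (measurableT_comp measurable_snd measurable_snd). Qed.

Ltac measurability :=
  repeat first
    [ assumption | exact: measurable_cst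
    | exact: measurable_location1 | exact: measurable_location2
    | exact: measurable_scale1 | exact: measurable_scale2
    | exact: measurable_fst | exact: measurable_snd
    | apply: measurable_fun_ifT | apply: measurable_and
    | apply: measurable_fun_ltr | apply: measurable_fun_ler
    | apply: measurable_fun_invr 
    | apply: measurable_fun_expR
    | apply: measurable_funX | apply: measurable_funB
    | apply: measurable_funM | apply: measurable_funD 
    | apply: measurable_funN ].

Lemma measurable_orderstat_pdf d (T : measurableType d) (R : realType) n a
    (mu sigma : T -> R) (x : R) :
  measurable_fun setT mu -> measurable_fun setT sigma ->
  measurable_fun setT (fun t => orderstat_pdf n a (mu t) (sigma t) x).
Proof. move=> mmu msigma; rewrite /orderstat_pdf; measurability. Qed.

Lemma measurable_gamma_pdf d (T : measurableType d) (R : realType) k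
    (sigma : T -> R) (v : R) :
  measurable_fun setT sigma ->
  measurable_fun setT (fun t => gamma_pdf k (sigma t) v).
Proof. by move=> msigma; rewrite /gamma_pdf; measurability. Qed.

Lemma measurable_likelihood (R : realType) n1 a1 b1 n2 a2 b2 (x : data R) :
  measurable_fun setT (likelihood n1 a1 b1 n2 a2 b2 x).
Proof.
rewrite /likelihood; repeat apply: measurable_funM;
  by [apply: measurable_orderstat_pdf; measurability|
      apply: measurable_gamma_pdf; measurability].
Qed.

Lemma measurable_prior (R : realType) (x : data R) :
  measurable_fun setT (prior x).
Proof.
rewrite /prior; measurability.
Qed.

(** * Iterated integrals and integration over the locations *)

Lemma lebesgue2_integral (R : realType) (f : plane R -> R) :
  measurable_fun setT f -> (forall s, 0 <= f s) ->
  (\int[@lebesgue2 R]_s (f s)%:E =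
   \int[lebesgue_measure]_s1 \int[lebesgue_measure]_s2 (f (s1, s2))%:E)%E.
Proof.
move=> mf f0.
by rewrite -[LHS]/(\int[@lebesgue_measure R \x @lebesgue_measure R]_s (f s)%:E)%E
  fubini_tonelli1//=; exact/measurable_EFinP.
Qed.

Lemma lebesgue4_integral (R : realType) (f : param R -> R) :
  measurable_fun setT f -> (forall th, 0 <= f th) ->
  (\int[@lebesgue4 R]_th (f th)%:E =
   \int[@lebesgue2 R]_s \int[@lebesgue2 R]_m (f (m, s))%:E)%E.
Proof.
move=> mf f0.
by rewrite /lebesgue4 fubini_tonelli2//=; exact/measurable_EFinP.
Qed.

Lemma orderstat_pdf_ge0 (R : realType) n a (mu sigma x : R) : 0 < sigma ->
  0 <= orderstat_pdf n a mu sigma x.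
Proof.
move=> s0; rewrite /orderstat_pdf; case: ifPn => // mux.
rewrite !mulr_ge0 ?exprn_ge0 ?expR_ge0 ?invr_ge0 ?mulr_ge0 ?(ltW s0)//.
by rewrite subr_ge0 -expR0 ler_expR oppr_le0 divr_ge0 ?subr_ge0 ?(ltW mux) ?ltW.
Qed.

Lemma gamma_pdf_ge0 (R : realType) k (sigma v : R) : 0 < sigma ->
  0 <= gamma_pdf k sigma v.
Proof.
move=> s0; rewrite /gamma_pdf; case: ifPn => // v0.
by rewrite divr_ge0 ?mulr_ge0 ?exprn_ge0 ?expR_ge0 ?ltW.
Qed.

(** [c] stands for the whole factor free of the locations. [K] is chosen before the scales and the
    data, so it can be pulled out of the outer integral over the scales. *)
Lemma integral_locations (R : realType) (n1 a1 n2 a2 : nat) :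
  exists2 K : R, 0 < K & forall c x1 x2 s1 s2 : R, 0 <= c -> 0 < s1 -> 0 < s2 ->
  (\int[@lebesgue2 R]_m (c * (orderstat_pdf n1 a1 m.1 s1 x1
     * orderstat_pdf n2 a2 m.2 s2 x2))%:E = (K * c)%:E)%E.
Proof.
have [K1 K10 HK1] := orderstat_pdf_integral R n1 a1.
have [K2 K20 HK2] := orderstat_pdf_integral R n2 a2.
exists (K1 * K2); first exact: mulr_gt0.
move=> c x1 x2 s1 s2 c0 s10 s20.
rewrite lebesgue2_integral; last 2 first.
- apply: measurable_funM; first exact: measurable_cst.
  by apply: measurable_funM; apply: measurable_orderstat_pdf; measurability.
- by move=> m; rewrite !mulr_ge0 ?orderstat_pdf_ge0.
under eq_integral => m1 _.
  under eq_integral do rewrite /= mulrA EFinM.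
  rewrite ge0_integralZl_EFin//=; last 3 first.
  - by move=> m2 _; rewrite lee_fin orderstat_pdf_ge0.
  - by apply/measurable_EFinP/measurable_orderstat_pdf; measurability.
  - by rewrite mulr_ge0 ?orderstat_pdf_ge0.
  rewrite HK2// -EFinM mulrAC EFinM.
  over.
rewrite ge0_integralZl_EFin//=; last 3 first.
- by move=> m2 _; rewrite lee_fin orderstat_pdf_ge0.
- by apply/measurable_EFinP/measurable_orderstat_pdf; measurability.
- by rewrite mulr_ge0 ?(ltW K20).
by rewrite HK1// -EFinM; congr EFin; ring.
Qed.

Lemma ratio_int_gt0 (R : realType) (m k : nat) (u : R) : 0 < u ->
  0 < ratio_int m k u /\
  (\int[lebesgue_measure]_(y in `[0%R, 1%R]) (y ^+ (m - 1) * (y * u + 1) ^- k)%:E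
   = (ratio_int m k u)%:E)%E.
Proof.
(* With [`|y|] the denominator never vanishes, so [h] is continuous on R. *)
move=> u0; pose h (y : R) := y ^+ (m - 1) * (`|y| * u + 1) ^- k.
have hE : (\int[lebesgue_measure]_(y in `[0%R, 1%R]) (y ^+ (m - 1) * (y * u + 1) ^- k)%:E
    = \int[lebesgue_measure]_(y in `[0%R, 1%R]) (h y)%:E)%E.
  by apply: eq_integral => y; rewrite inE/= in_itv/= /h => /andP[y0 _]; rewrite ger0_norm.
have den0 (y : R) : 0 < `|y| * u + 1 by rewrite ltr_wpDl// mulr_ge0// ltW.
have ch (y : R) : {for y, continuous h}.
  apply: continuousM; first exact: exprn_continuous.
  apply: (@continuousV _ _ (fun y : R => (`|y| * u + 1) ^+ k)).
    by rewrite expf_neq0// gt_eqF.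
  apply: (@continuous_comp R R R (fun y : R => `|y| * u + 1) (fun y : R => y ^+ k)).
    apply: continuousD; last exact: cst_continuous.
    by apply: continuousM; [exact: norm_continuous|exact: cst_continuous].
  exact: exprn_continuous.
have /andP[I0 Ioo] : (0 < \int[lebesgue_measure]_(y in `[0%R, 1%R]) (h y)%:E < +oo)%E.
  apply: continuous_integral01_gt0 => // y /andP[y0 y1].
  by rewrite mulr_gt0 ?exprn_gt0// invr_gt0 exprn_gt0.
rewrite /ratio_int /Rintegral hE fineK; last by rewrite ge0_fin_numE// ltW.
by split=> //; rewrite fine_gt0// I0.
Qed.

(** * Integration over the scales *)

Lemma invgamma_mixture_integral (R : realType) (q k : nat) (D v1 v2 : R) :
  0 <= D -> 0 < v1 -> 0 < v2 ->
  (\int[lebesgue_measure]_(s in `]0%R, +oo[) \int[lebesgue_measure]_(y in `[0%R, 1%R])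
     (D * (y ^+ (q - 1) * (s^-1 ^+ k.+2 * expR (- ((v1 + v2 * y) / s)))))%:E =
   (D * (k`!%:R / v1 ^+ k.+1) * ratio_int q k.+1 (v2 / v1))%:E)%E.
Proof.
move=> D0 v10 v20.
(* Extension by 0 to the whole plane, where Tonelli's theorem applies. *)
pose f (t : plane R) : R := if [&& 0 < t.1, 0 <= t.2 & t.2 <= 1] then
  D * (t.2 ^+ (q - 1) * (t.1^-1 ^+ k.+2 * expR (- ((v1 + v2 * t.2) / t.1))))
  else 0.
have f0 t : 0 <= f t.
  rewrite /f; case: ifPn => // /and3P[t1 t2 _].
  by rewrite mulr_ge0// mulr_ge0 ?exprn_ge0// mulr_ge0 ?expR_ge0// exprn_ge0// invr_ge0 ltW.
have mf : measurable_fun setT f by rewrite /f; measurability.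
transitivity (\int[lebesgue_measure]_s \int[lebesgue_measure]_y (f (s, y))%:E)%E.
  rewrite integral_mkcond; apply: eq_integral => s _.
  rewrite patchE mem_setE in_itv/= andbT; case: ifPn => s0.
    rewrite integral_mkcond; apply: eq_integral => y _.
    by rewrite patchE mem_setE in_itv/= /f/= s0/=; case: ifPn.
  by rewrite integral0_eq// => y _; rewrite /f/= (negbTE s0).
(* After the swap, the inner integral over [s] at fixed [y] is an inverse gamma integral with rate
   [v1 + v2 * y]. *)
rewrite (fubini_tonelli (fun t => (f t)%:E)); last 2 first.
- exact/measurable_EFinP.
- by move=> t; rewrite lee_fin.
have [_ rE] := ratio_int_gt0 q k.+1 (divr_gt0 v20 v10).
rewrite EFinM -rE -ge0_integralZl_EFin//; last 3 first.
- move=> y /=; rewrite in_itv/= => /andP[y0 y1].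
  rewrite lee_fin mulr_ge0 ?exprn_ge0// invr_ge0 exprn_ge0// addr_ge0// mulr_ge0//.
  by rewrite divr_ge0 ?ltW.
- by apply/measurable_EFinP/measurable_funTS; measurability.
- by rewrite mulr_ge0// divr_ge0 ?exprn_ge0 ?ltW.
rewrite [RHS]integral_mkcond; apply: eq_integral => y _.
rewrite patchE mem_setE in_itv/=; case: ifPn => y01; last first.
  by rewrite integral0_eq// => s _; rewrite /f/= (negbTE y01) andbF.
have /andP[y0 y1] := y01.
have c0 : 0 < v1 + v2 * y by rewrite ltr_pwDl// mulr_ge0// ltW.
transitivity ((D * y ^+ (q - 1))%:E * (k`!%:R / (v1 + v2 * y) ^+ k.+1)%:E)%E.
  rewrite -(invgamma_integral k c0) -ge0_integralZl_EFin//; last 3 first.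
  - move=> s /=; rewrite in_itv/= andbT => s0.
    by rewrite lee_fin mulr_ge0 ?expR_ge0// exprn_ge0// invr_ge0 ltW.
  - by apply/measurable_EFinP/measurable_funTS; measurability.
  - by rewrite mulr_ge0 ?exprn_ge0.
  rewrite [RHS]integral_mkcond; apply: eq_integral => s _.
  rewrite patchE mem_setE in_itv/= andbT /f/= y01 andbT; case: ifPn => // _.
  by rewrite -EFinM mulrA.
rewrite -EFinM; congr EFin.
(* Factoring out [v1] exposes the integrand of [ratio_int] at [u = v2 / v1]. *)
have -> : v1 + v2 * y = v1 * (y * (v2 / v1) + 1) by field; rewrite gt_eqF.
by rewrite exprMn invfM; ring.
Qed.

(** The equation on [t] encodes [t = s^-j] with [k = p + q + j - 1], using natural exponents only;
    it thus covers [j = -1] together with the other moments. The proof is the substitution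
    [y = s / z]. *)
Lemma integral_scale2 (R : realType) (p q k : nat) (v1 v2 s t : R) :
  (0 < q)%N -> 0 < v1 -> 0 < v2 -> 0 < s -> s^-1 ^+ (p + q) * t = s^-1 ^+ k.+1 ->
  (\int[lebesgue_measure]_(z in `[s, +oo[)
     ((s * z)^-1 * (gamma_pdf p s v1 * gamma_pdf q z v2) * t)%:E =
   \int[lebesgue_measure]_(y in `[0%R, 1%R])
     (v1 ^+ p.-1 * v2 ^+ q.-1 / (p.-1`!%:R * q.-1`!%:R) *
       (y ^+ (q - 1) * (s^-1 ^+ k.+2 * expR (- ((v1 + v2 * y) / s)))))%:E)%E.
Proof.
case: q => // q _ v10 v20 s0 tE; rewrite subn1/=.
set D := v1 ^+ _ * _ / _.
have D0 : 0 <= D by rewrite /D divr_ge0 ?mulr_ge0 ?exprn_ge0 ?ltW.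
pose h (y : R) := D * (y ^+ q * (s^-1 ^+ k.+2 * expR (- ((v1 + v2 * y) / s)))).
have h0 (y : R) : 0 <= y -> 0 <= h y.
  move=> y0; rewrite mulr_ge0// mulr_ge0 ?exprn_ge0// mulr_ge0 ?expR_ge0//.
  by rewrite exprn_ge0// invr_ge0 ltW.
have ch (y : R) : {for y, continuous h}.
  apply: continuousM; first exact: cst_continuous.
  apply: continuousM; first exact: exprn_continuous.
  apply: continuousM; first exact: cst_continuous.
  apply: (@continuous_comp R R R (fun y => - ((v1 + v2 * y) / s)) expR).
    apply: continuousN; apply: continuousM; last exact: cst_continuous.
    apply: continuousD; first exact: cst_continuous.
    by apply: continuousM; [exact: cst_continuous|exact: cvg_id].
  exact: continuous_expR.
rewrite -[RHS]/(\int[lebesgue_measure]_(y in `[0%R, 1%R]) (h y)%:E)%E.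
rewrite -(integration_by_substitution_invr s0 ch); last by move=> y /andP[/h0].
apply: eq_integral => z; rewrite inE/= in_itv/= andbT => sz; congr EFin.
have z0 := lt_le_trans s0 sz.
rewrite /h /gamma_pdf v10 v20 /D.
have -> : (v1 + v2 * (s / z)) / s = v1 / s + v2 / z by field; rewrite !gt_eqF.
rewrite opprD expRD (exprS s^-1) -tE.
rewrite -pred_Sn exprD exprMn !exprVn [s ^+ q.+1]exprS [z ^+ q.+1]exprS.
have fact0 n : n`!%:R != 0 :> R by rewrite pnatr_eq0 -lt0n fact_gt0.
move: (s ^+ p) (s ^+ q) (z ^+ q) (_`!%:R) (q`!%:R) (expf_neq0 p (lt0r_neq0 s0))
  (expf_neq0 q (lt0r_neq0 s0)) (expf_neq0 q (lt0r_neq0 z0)) (fact0 p.-1) (fact0 q).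
move=> sp sq zq fp fq sp0 sq0 zq0 fp0 fq0.
by field; rewrite sp0 sq0 zq0 fp0 fq0 !lt0r_neq0.
Qed.

(** Up to a constant factor, the posterior density of the two scales once the locations are
    integrated out, weighted by [h sigma_1]. *)
Definition scales_kernel (R : realType) (p q : nat) (v1 v2 : R) (h : R -> R)
    (s : plane R) : R :=
  if [&& 0 < s.1, 0 < s.2 & s.1 <= s.2]
  then (s.1 * s.2)^-1 * (gamma_pdf p s.1 v1 * gamma_pdf q s.2 v2) * h s.1
  else 0.

Lemma measurable_scales_kernel (R : realType) (p q : nat) (v1 v2 : R) (h : R -> R) :
  measurable_fun setT h -> measurable_fun setT (scales_kernel p q v1 v2 h).
Proof.
move=> mh; apply: measurable_fun_ifT; [by measurability| |by measurability].
apply: measurable_funM; last exact: (measurableT_comp mh measurable_fst).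
apply: measurable_funM; first by measurability.
by apply: measurable_funM; apply: measurable_gamma_pdf; measurability.
Qed.

Lemma scales_kernel_ge0 (R : realType) (p q : nat) (v1 v2 : R) (h : R -> R) s :
  (forall s, 0 < s -> 0 <= h s) -> 0 <= scales_kernel p q v1 v2 h s.
Proof.
move=> h0; rewrite /scales_kernel; case: ifPn => // /and3P[s1 s2 _].
by rewrite !mulr_ge0 ?gamma_pdf_ge0 ?h0// invr_ge0 mulr_ge0 ?ltW.
Qed.

Lemma integral_scales (R : realType) (p q k : nat) (v1 v2 : R) (h : R -> R) :
  (0 < q)%N -> 0 < v1 -> 0 < v2 -> measurable_fun setT h ->
  (forall s, 0 < s -> 0 <= h s) ->
  (forall s, 0 < s -> s^-1 ^+ (p + q) * h s = s^-1 ^+ k.+1) ->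
  (\int[@lebesgue2 R]_s (scales_kernel p q v1 v2 h s)%:E =
   (v1 ^+ p.-1 * v2 ^+ q.-1 / (p.-1`!%:R * q.-1`!%:R)
     * (k`!%:R / v1 ^+ k.+1 * ratio_int q k.+1 (v2 / v1)))%:E)%E.
Proof.
move=> q0 v10 v20 mh h0 hE.
rewrite lebesgue2_integral; last 2 first.
- exact: measurable_scales_kernel.
- by move=> s; exact: scales_kernel_ge0.
set D := v1 ^+ _ * _ / _.
have D0 : 0 <= D by rewrite /D divr_ge0 ?mulr_ge0 ?exprn_ge0 ?ltW.
rewrite mulrA -(invgamma_mixture_integral _ _ D0 v10 v20).
rewrite [RHS]integral_mkcond; apply: eq_integral => s _.
rewrite patchE mem_setE in_itv/= andbT; case: ifPn => s0; last first.
  by rewrite integral0_eq// => z _ /=; rewrite /scales_kernel (negbTE s0).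
rewrite -(integral_scale2 q0 v10 v20 s0 (hE s s0)) [RHS]integral_mkcond.
apply: eq_integral => z _; rewrite /scales_kernel.
rewrite patchE mem_setE in_itv/= andbT s0/=; case: (leP s z) => sz; last by rewrite andbF.
by rewrite (lt_le_trans s0 sz).
Qed.

(** The restriction of each location in the prior is absorbed by [orderstat_pdf], which vanishes
    beyond the observation; the locations and the scales then separate. *)
Lemma prior_likelihood_factor (R : realType) n1 a1 b1 n2 a2 b2 (x : data R)
    (h : R -> R) (m s : plane R) :
  prior x (m, s) * likelihood n1 a1 b1 n2 a2 b2 x (m, s) * h s.1 =
  scales_kernel (b1 - a1) (b2 - a2) (V1 x) (V2 x) h s
  * (orderstat_pdf n1 a1 m.1 s.1 (X1 x) * orderstat_pdf n2 a2 m.2 s.2 (X2 x)).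
Proof.
rewrite /prior /likelihood /location1 /location2 /scale1 /scale2 /=.
have [x1|x1] := ltP m.1 (X1 x); last first.
  by rewrite !mul0r /orderstat_pdf ltNge x1/= mul0r mulr0.
have [x2|x2] := ltP m.2 (X2 x); last first.
  by rewrite !mul0r /orderstat_pdf [m.2 < _]ltNge x2/= !mulr0.
rewrite /scales_kernel /=; case: ifPn => _; last by rewrite !mul0r.
by ring.
Qed.

(** [C] depends on the data but is fixed before [k] and [h]: it is common to all moments and cancels
    against the marginal. *)
Lemma prior_likelihood_integral (R : realType) n1 a1 b1 n2 a2 b2 (x : data R) :
  (a2 < b2)%N -> 0 < V1 x -> 0 < V2 x ->
  exists2 C : R, 0 < C & forall (k : nat) (h : R -> R),
    measurable_fun setT h -> (forall s, 0 < s -> 0 <= h s) ->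
    (forall s, 0 < s -> s^-1 ^+ (b1 - a1 + (b2 - a2)) * h s = s^-1 ^+ k.+1) ->
  (\int[@lebesgue4 R]_th
     (prior x th * likelihood n1 a1 b1 n2 a2 b2 x th * h (scale1 th))%:E =
   (C * (k`!%:R / V1 x ^+ k.+1 * ratio_int (b2 - a2) k.+1 (Z1 x)))%:E)%E.
Proof.
move=> ab2 v10 v20.
have [K K0 HK] := integral_locations R n1 a1 n2 a2.
set p := (b1 - a1)%N; set q := (b2 - a2)%N.
have q0 : (0 < q)%N by rewrite subn_gt0.
exists (K * (V1 x ^+ p.-1 * V2 x ^+ q.-1 / (p.-1`!%:R * q.-1`!%:R))).
  by rewrite mulr_gt0// divr_gt0 ?mulr_gt0 ?exprn_gt0// ltr0n fact_gt0.
move=> k h mh h0 hE.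
rewrite lebesgue4_integral; last 2 first.
- apply: measurable_funM; last exact: (measurableT_comp mh (@measurable_scale1 R)).
  by apply: measurable_funM; [exact: measurable_prior|exact: measurable_likelihood].
- move=> [m s]; rewrite prior_likelihood_factor.
  rewrite /scales_kernel; case: ifPn => [/and3P[s1 s2 _]|_]; last by rewrite mul0r.
  rewrite mulr_ge0//; last by rewrite mulr_ge0 ?orderstat_pdf_ge0.
  by rewrite !mulr_ge0 ?gamma_pdf_ge0 ?h0// invr_ge0 mulr_ge0 ?ltW.
rewrite -mulrA EFinM -(integral_scales q0 v10 v20 mh h0 hE).
rewrite -ge0_integralZl_EFin//; last 3 first.
- by move=> s _; rewrite lee_fin scales_kernel_ge0.
- by apply/measurable_EFinP; exact: measurable_scales_kernel.
- exact: ltW.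
apply: eq_integral => s _.
under eq_integral do rewrite prior_likelihood_factor.
(* [HK] holds for positive scales only; off the parameter set the kernel makes both sides 0. *)
have [/and3P[s1 s2 _]|/negbTE s0] := boolP [&& 0 < s.1, 0 < s.2 & s.1 <= s.2].
  by rewrite HK ?scales_kernel_ge0// EFinM.
have -> : scales_kernel p q (V1 x) (V2 x) h s = 0 by rewrite /scales_kernel s0.
by rewrite mule0 integral0_eq// => m _; rewrite mul0r.
Qed.

(** * Posterior risks *)

Section laurent_moments.
Context d (T : measurableType d) (R : realType) (mu : {measure set T -> \bar R}).
Context (w s : T -> R) (m_1 m0 m1 m2 : R)
  (mw : measurable_fun setT w) (ms : measurable_fun setT s)
  (w0 : forall t, 0 <= w t) (ws : forall t, s t <= 0 -> w t = 0)
  (I_1 : (\int[mu]_t (w t * s t)%:E = m_1%:E)%E)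
  (I0 : (\int[mu]_t (w t)%:E = m0%:E)%E)
  (I1 : (\int[mu]_t (w t * (s t)^-1)%:E = m1%:E)%E)
  (I2 : (\int[mu]_t (w t * (s t)^-1 ^+ 2)%:E = m2%:E)%E).

(** The coefficients belong to [z^-j] for [j = -1, 0, 1, 2] in this order, matching the moments
    [m_1], [m0], [m1], [m2]; [m_1] is the moment of [s] itself. *)
Definition laurent (c : R * R * R * R) (z : R) : R :=
  c.1.1.1 * z + c.1.1.2 + c.1.2 * z^-1 + c.2 * z^-1 ^+ 2.

Let has_integral (f : T -> R) (m : R) :=
  mu.-integrable setT (EFin \o f) /\ (\int[mu]_t (f t)%:E = m%:E)%E.

Let ge0_has_integral (f : T -> R) (m : R) : measurable_fun setT f ->
  (forall t, 0 <= f t) -> (\int[mu]_t (f t)%:E = m%:E)%E -> has_integral f m.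
Proof.
move=> mf f0 If; split=> //; apply/integrableP; split; first exact/measurable_EFinP.
by under eq_integral => t _ do rewrite /= ger0_norm//; rewrite If ltry.
Qed.

Let has_integralZ k f m : has_integral f m -> has_integral (fun t => k * f t) (k * m).
Proof.
move=> [mf If]; split.
  by apply: eq_integrable (integrableZl measurableT k mf) => // t _; rewrite /= EFinM.
by under eq_integral do rewrite EFinM; rewrite integralZl// If.
Qed.

Let has_integralD f g m n : has_integral f m -> has_integral g n ->
  has_integral (fun t => f t + g t) (m + n).
Proof.
move=> [mf If] [mg Ig]; split.
  by apply: eq_integrable (integrableD measurableT mf mg) => // t _; rewrite /= EFinD.
by under eq_integral do rewrite EFinD; rewrite integralD// If Ig.
Qed.

Let ws0 t (x : R) : (0 < s t -> 0 <= x) -> 0 <= w t * x.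
Proof.
move=> x0; have [/ws ->|/x0] := leP (s t) 0; first by rewrite mul0r.
exact: mulr_ge0.
Qed.

Lemma laurent_integral c :
  mu.-integrable setT (EFin \o (fun t => w t * laurent c (s t))) /\
  (\int[mu]_t (w t * laurent c (s t))%:E =
   (c.1.1.1 * m_1 + c.1.1.2 * m0 + c.1.2 * m1 + c.2 * m2)%:E)%E.
Proof.
rewrite -/(has_integral (fun t => w t * laurent c (s t)) _).
have -> : (fun t => w t * laurent c (s t)) =
    (fun t => c.1.1.1 * (w t * s t) + c.1.1.2 * w t + c.1.2 * (w t * (s t)^-1)
      + c.2 * (w t * (s t)^-1 ^+ 2)).
  by apply/funext => t; rewrite /laurent; ring.
apply: has_integralD; [apply: has_integralD; [apply: has_integralD|]|];
  apply: has_integralZ; apply: ge0_has_integral => //; try by measurability.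
- by move=> t; apply: ws0 => /ltW.
- by move=> t; apply: ws0 => st; rewrite invr_ge0 ltW.
- by move=> t; apply: ws0 => st; rewrite exprn_ge0// invr_ge0 ltW.
Qed.

(** [f] is the loss of the announced action and [g] that of a competitor. The majorant [e] makes [f]
    integrable against [w], so the integral of [g] splits into that of [f] plus the explicit moment
    combination for [c]. Pointwise relations are asked for positive [z] only, since [w] vanishes
    where [s] is not positive. *)
Lemma le_integral_laurent (f g : R -> R) c e :
  measurable_fun setT f -> measurable_fun setT g ->
  (forall z, 0 < z -> 0 <= f z) ->
  (forall z, 0 < z -> f z <= laurent e z) ->
  (forall z, 0 < z -> g z = f z + laurent c z) ->
  0 <= c.1.1.1 * m_1 + c.1.1.2 * m0 + c.1.2 * m1 + c.2 * m2 ->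
  (\int[mu]_t (f (s t) * w t)%:E < +oo /\
   \int[mu]_t (f (s t) * w t)%:E <= \int[mu]_t (g (s t) * w t)%:E)%E.
Proof.
move=> mf mg f0 fe gf c0.
have [ie Ie] := laurent_integral e; have [ic Ic] := laurent_integral c.
have mfw : measurable_fun setT (fun t => f (s t) * w t).
  by apply: measurable_funM => //; exact: measurableT_comp.
have fw0 t : 0 <= f (s t) * w t by rewrite mulrC; apply: ws0; exact: f0.
have foo : (\int[mu]_t (f (s t) * w t)%:E < +oo)%E.
  apply: (@le_lt_trans _ _ (\int[mu]_t (w t * laurent e (s t))%:E)%E);
    last by rewrite Ie ltry.
  apply: ge0_le_integral => //.
  - by move=> t _; rewrite lee_fin.
  - exact/measurable_EFinP.
  - by case/integrableP: ie.
  - move=> t _; rewrite lee_fin mulrC.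
    have [/ws ->|st] := leP (s t) 0; first by rewrite !mul0r.
    by rewrite ler_wpM2l// fe.
split=> //.
have iff : mu.-integrable setT (EFin \o (fun t => f (s t) * w t)).
  apply/integrableP; split; first exact/measurable_EFinP.
  by under eq_integral => t _ do rewrite /= ger0_norm//.
have -> : (\int[mu]_t (g (s t) * w t)%:E =
   \int[mu]_t ((f (s t) * w t)%:E + (w t * laurent c (s t))%:E))%E.
  apply: eq_integral => t _; rewrite -EFinD; congr EFin.
  have [/ws ->|st] := leP (s t) 0; first by rewrite !mul0r !mulr0 addr0.
  by rewrite gf// mulrDl [w t * _]mulrC.
by rewrite integralD// Ic leeDl// lee_fin.
Qed.

End laurent_moments.

(** With [k = N + j - 1] and [N = b - a], this is the posterior moment of sigma_1^-j up to a factor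
    free of [j]. *)
Definition scale_moment (R : realType) (q k : nat) (v u : R) : R :=
  k`!%:R / v ^+ k.+1 * ratio_int q k.+1 u.

Lemma scale_moment_gt0 (R : realType) (q k : nat) (v u : R) : 0 < v -> 0 < u ->
  0 < scale_moment q k v u.
Proof.
move=> v0 u0; have [r0 _] := ratio_int_gt0 q k.+1 u0.
by rewrite mulr_gt0// divr_gt0 ?exprn_gt0// ltr0n fact_gt0.
Qed.

(** Optimality is reduced to algebra. Since [n = N - 2], the numbers [M n], ..., [M n.+3] are the
    moments for [j = -1, 0, 1, 2]. The majorant [e] gives finite risk, and [c] describes the excess
    loss of [d], whose expectation must be nonnegative. *)
Lemma generalized_Bayes_laurent (R : realType) (n1 a1 b1 n2 a2 b2 n : nat)
    (L : R -> R) (delta : data R -> R) :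
  (a2 < b2)%N -> (b1 - a1 + (b2 - a2))%N = n.+2 ->
  measurable_fun setT L -> (forall t, 0 < t -> 0 <= L t) ->
  (forall x : data R, 0 < V1 x -> 0 < V2 x ->
    let M k := scale_moment (b2 - a2) k (V1 x) (Z1 x) in
    [/\ 0 < delta x,
        exists e, forall z, 0 < z -> L (delta x / z) <= laurent e z &
        forall d, 0 < d -> exists2 c,
          forall z, 0 < z -> L (d / z) = L (delta x / z) + laurent c z &
          0 <= c.1.1.1 * M n + c.1.1.2 * M n.+1 + c.1.2 * M n.+2 + c.2 * M n.+3]) ->
  generalized_Bayes (@prior R) (@likelihood R n1 a1 b1 n2 a2 b2) L delta.
Proof.
move=> ab2 pqn mL L0 H x v10 v20.
have u0 : 0 < Z1 x by rewrite divr_gt0.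
have [d0 [e He] Hc] := H x v10 v20.
have [C C0 HC] := prior_likelihood_integral n1 a1 b1 n2 ab2 v10 v20.
rewrite pqn in HC.
pose M k := scale_moment (b2 - a2) k (V1 x) (Z1 x).
have M0 k : 0 < M k by exact: scale_moment_gt0.
pose lik := @likelihood R n1 a1 b1 n2 a2 b2.
(* The normalizing constant is the moment [j = 0], with weight [h = 1]. *)
have marginalE : marginal (@prior R) lik x = (C * M n.+1)%:E.
  rewrite -[RHS](HC n.+1 (cst 1)) ?mulr1//.
  - by apply: eq_integral => th _; rewrite mulr1.
  - by move=> s _; rewrite mulr1.
have B0 : 0 < C * M n.+1 by rewrite mulr_gt0.
pose w := posterior (@prior R) lik x.
have wE th : w th = (C * M n.+1)^-1 * (prior x th * lik x th).
  by rewrite /w /posterior marginalE mulrC.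
have pl0 th : 0 <= prior x th * lik x th.
  rewrite /prior; case: ifPn => [|_]; last by rewrite mul0r.
  move=> /and5P[_ _ s1 s2 _].
  by rewrite !mulr_ge0 ?orderstat_pdf_ge0 ?gamma_pdf_ge0// invr_ge0 mulr_ge0 ?ltW.
have plm : measurable_fun setT (fun th => prior x th * lik x th).
  by apply: measurable_funM; [exact: measurable_prior|exact: measurable_likelihood].
have w0 th : 0 <= w th by rewrite wE mulr_ge0// invr_ge0 ltW.
have mw : measurable_fun setT w.
  have -> : w = (fun th => (C * M n.+1)^-1 * (prior x th * lik x th)).
    by apply/funext => th; rewrite wE.
  by apply: measurable_funM.
have ws th : scale1 th <= 0 -> w th = 0.
  by move=> s1; rewrite wE /prior (ltNge 0 (scale1 th)) s1/= !andbF mul0r mulr0.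
have wI (k : nat) (h : R -> R) : measurable_fun setT h -> (forall s, 0 < s -> 0 <= h s) ->
    (forall s, 0 < s -> s^-1 ^+ n.+2 * h s = s^-1 ^+ k.+1) ->
    (\int[@lebesgue4 R]_th (w th * h (scale1 th))%:E = (M k / M n.+1)%:E)%E.
  move=> mh h0 hE.
  under eq_integral do rewrite wE -mulrA EFinM.
  rewrite ge0_integralZl_EFin//; last 3 first.
  - move=> th _; rewrite lee_fin; have [s1|s1] := ltP 0 (scale1 th).
      by rewrite mulr_ge0// h0.
    by rewrite /prior (ltNge 0 (scale1 th)) s1/= !andbF !mul0r.
  - apply/measurable_EFinP; apply: measurable_funM => //.
    exact: (measurableT_comp mh (@measurable_scale1 R)).
  - by rewrite invr_ge0 ltW.
  rewrite (HC k)// -EFinM; congr EFin; rewrite -[_ * ratio_int _ _ _]/(M k).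
  by field; rewrite !gt_eqF.
have I_1 : (\int[@lebesgue4 R]_th (w th * scale1 th)%:E = (M n / M n.+1)%:E)%E.
  apply: (wI n id) => //; first by move=> s /ltW.
  by move=> s s0; rewrite exprSr -mulrA mulVf ?gt_eqF// mulr1.
have I0 : (\int[@lebesgue4 R]_th (w th)%:E = (M n.+1 / M n.+1)%:E)%E.
  rewrite -(wI n.+1 (cst 1))//; first by apply: eq_integral => th _; rewrite mulr1.
  by move=> s _; rewrite mulr1.
have I1 : (\int[@lebesgue4 R]_th (w th * (scale1 th)^-1)%:E = (M n.+2 / M n.+1)%:E)%E.
  apply: (wI n.+2 GRing.inv).
  - by apply: measurable_fun_invr; exact: measurable_id.
  - by move=> s s0; rewrite invr_ge0 ltW.
  - by move=> s _; rewrite -exprSr.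
have I2 : (\int[@lebesgue4 R]_th (w th * (scale1 th)^-1 ^+ 2)%:E = (M n.+3 / M n.+1)%:E)%E.
  apply: (wI n.+3 (fun s => s^-1 ^+ 2)).
  - by apply: measurable_funX; apply: measurable_fun_invr; exact: measurable_id.
  - by move=> s s0; rewrite exprn_ge0// invr_ge0 ltW.
  - by move=> s _; rewrite -exprD addn2.
have mLd (d : R) : measurable_fun setT (fun z : R => L (d / z)).
  apply: (measurableT_comp mL); apply: measurable_funM; first exact: measurable_cst.
  by apply: measurable_fun_invr; exact: measurable_id.
have risk (d : R) c : 0 < d ->
    (forall z, 0 < z -> L (d / z) = L (delta x / z) + laurent c z) ->
    0 <= c.1.1.1 * M n + c.1.1.2 * M n.+1 + c.1.2 * M n.+2 + c.2 * M n.+3 ->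
  (posterior_risk (@prior R) lik L x (delta x) < +oo /\
   posterior_risk (@prior R) lik L x (delta x) <= posterior_risk (@prior R) lik L x d)%E.
  move=> dpos Hd cM.
  apply: (le_integral_laurent mw (@measurable_scale1 R) w0 ws I_1 I0 I1 I2
    (mLd (delta x)) (mLd d) _ He Hd).
    by move=> z z0; rewrite L0// divr_gt0.
  (* Normalizing divides all moments by the same positive [M n.+1], which preserves the sign of the
     combination. *)
  move: (M n) (M n.+1) (M n.+2) (M n.+3) (M0 n.+1) cM => A B E F Bp cM.
  by rewrite !mulrA -!mulrDl divr_ge0// ltW.
(* Comparing [delta x] with itself extracts the finiteness of its risk. *)
have [c0 Hc0 cM0] := Hc _ d0.
split=> //.
- by rewrite marginalE lte_fin.
- by rewrite marginalE ltry.
- by have [] := risk _ _ d0 Hc0 cM0.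
- by move=> d dpos; have [c Hcd cM] := Hc d dpos; have [] := risk _ _ dpos Hcd cM.
Qed.

(** * Optimality for the three losses *)

Lemma ln_leB1 (R : realType) (t : R) : 0 < t -> ln t <= t - 1.
Proof.
move=> t0; have -> : ln t = ln (1 + (t - 1)) by rewrite addrC subrK.
by apply: le_ln1Dx; rewrite ltrBrDl subrr.
Qed.

(** The inequality [ln t <= t - 1] gives the lower bound; the same inequality at [t^-1] bounds
    [- ln t] and gives the upper one. *)
Lemma loss2_bounds (R : realType) (t : R) : 0 < t -> 0 <= loss2 t <= t + t^-1.
Proof.
move=> t0; rewrite /loss2; have := ln_leB1 t0.
have : ln t^-1 <= t^-1 - 1 by apply: ln_leB1; rewrite invr_gt0.
by rewrite lnV ?posrE//; lra.
Qed.

Lemma loss3_ge0 (R : realType) (t : R) : 0 < t -> 0 <= loss3 t.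
Proof.
move=> t0; have -> : loss3 t = (t - 1) ^+ 2 / t by rewrite /loss3; field; rewrite gt_eqF.
by rewrite divr_ge0 ?sqr_ge0 ?ltW.
Qed.

Lemma subnDD (a1 b1 a2 b2 : nat) : (a1 <= b1)%N -> (a2 <= b2)%N ->
  (b1 + b2 - (a1 + a2) = b1 - a1 + (b2 - a2))%N.
Proof. by move=> ab1 ab2; rewrite subnDA addnC -addnBA // addnC addnBA. Qed.

(** First-order condition for [loss1]: the optimal [D] satisfies [D * E[sigma_1^-2] =
    E[sigma_1^-1]]. *)
Lemma phi01E (R : realType) (a1 b1 a2 b2 n : nat) (v u : R) : 0 < v -> 0 < u ->
  (b1 + b2 - (a1 + a2))%N = n.+2 ->
  phi01 a1 b1 a2 b2 u * v * scale_moment (b2 - a2) n.+3 v u =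
  scale_moment (b2 - a2) n.+2 v u.
Proof.
move=> v0 u0 ban; rewrite /phi01 ban addn1 addn2 /scale_moment [n.+3`!]factS natrM.
have [r0 _] := ratio_int_gt0 (b2 - a2) n.+4 u0.
rewrite [v ^+ n.+4]exprS; field.
by rewrite !gt_eqF ?exprn_gt0.
Qed.

(** First-order condition for [loss2]: [D * E[sigma_1^-1] = 1], cleared of the normalization. *)
Lemma phi02E (R : realType) (a1 b1 a2 b2 n : nat) (v u : R) : 0 < v -> 0 < u ->
  (b1 + b2 - (a1 + a2))%N = n.+2 ->
  phi02 a1 b1 a2 b2 u * v * scale_moment (b2 - a2) n.+2 v u =
  scale_moment (b2 - a2) n.+1 v u.
Proof.
move=> v0 u0 ban; rewrite /phi02 ban addn1 /scale_moment [n.+2`!]factS natrM.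
have [r0 _] := ratio_int_gt0 (b2 - a2) n.+3 u0.
rewrite [v ^+ n.+3]exprS; field.
by rewrite !gt_eqF ?exprn_gt0.
Qed.

(** First-order condition for [loss3]: [D ^+ 2 * E[sigma_1^-1] = E[sigma_1]], whence the square root
    in [phi03]. *)
Lemma phi03E (R : realType) (a1 b1 a2 b2 n : nat) (v u : R) : 0 < v -> 0 < u ->
  (b1 + b2 - (a1 + a2))%N = n.+2 ->
  (phi03 a1 b1 a2 b2 u * v) ^+ 2 * scale_moment (b2 - a2) n.+2 v u =
  scale_moment (b2 - a2) n v u.
Proof.
move=> v0 u0 ban; have [r0 _] := ratio_int_gt0 (b2 - a2) n.+3 u0.
have [r1 _] := ratio_int_gt0 (b2 - a2) n.+1 u0.
rewrite exprMn /phi03 ban addn1 subn1 sqr_sqrtr; last first.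
  by rewrite mulr_ge0 ?invr_ge0// divr_ge0 ?ltW.
rewrite /scale_moment !factS !natrM -pred_Sn.
rewrite [v ^+ n.+3]exprS [v ^+ n.+2]exprS; field.
by rewrite !gt_eqF ?exprn_gt0.
Qed.

Lemma phi_gt0 (R : realType) (a1 b1 a2 b2 n : nat) (u : R) : 0 < u ->
  (b1 + b2 - (a1 + a2))%N = n.+2 ->
  [/\ 0 < phi01 a1 b1 a2 b2 u, 0 < phi02 a1 b1 a2 b2 u & 0 < phi03 a1 b1 a2 b2 u].
Proof.
move=> u0 ban; have r0 k : 0 < ratio_int (b2 - a2) k u.
  by have [] := ratio_int_gt0 (b2 - a2) k u0.
rewrite /phi01 /phi02 /phi03 ban sqrtr_gt0; split;
  by rewrite mulr_gt0 ?divr_gt0// invr_gt0 ltr0n// addn1.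
Qed.

(** By [phi01E] the excess risk of [d] over [D] is a positive multiple of [(d - D) ^+ 2]. *)
Lemma generalized_Bayes_loss1 (R : realType) (n1 a1 b1 n2 a2 b2 n : nat) :
  (a1 <= b1)%N -> (a2 < b2)%N -> (b1 - a1 + (b2 - a2))%N = n.+2 ->
  generalized_Bayes (@prior R) (@likelihood R n1 a1 b1 n2 a2 b2) (@loss1 R)
    (fun x : data R => phi01 a1 b1 a2 b2 (Z1 x) * V1 x).
Proof.
move=> ab1 ab2 pqn; have ban := pqn; rewrite -subnDD ?(ltnW ab2)// in ban.
apply: generalized_Bayes_laurent pqn _ _ _ => //.
- have mid : measurable_fun setT (fun t : R => t) by exact: measurable_id.
  by rewrite /loss1; measurability.
- by move=> t _; exact: sqr_ge0.
move=> x v0 v20; have u0 : 0 < Z1 x by rewrite divr_gt0.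
have [p0 _ _] := phi_gt0 u0 ban; have := phi01E v0 u0 ban.
move: (_ * V1 x) (mulr_gt0 p0 v0) => D D0 ME M.
have M0 k : 0 < M k by exact: scale_moment_gt0.
split => //.
  (* The majorant drops the negative cross term of the square. *)
  exists (0, 1, 0, D ^+ 2) => z z0; rewrite /loss1 /laurent/=.
  have : 0 < D / z by rewrite divr_gt0.
  by rewrite -exprMn; nra.
move=> d d0; exists (0, 0, - 2 * (d - D), d ^+ 2 - D ^+ 2) => /=.
  by move=> z z0; rewrite /loss1 /laurent/=; ring.
rewrite -[M n.+2]ME.
have -> : 0 * M n + 0 * M n.+1 + - 2 * (d - D) *
    (D * scale_moment (b2 - a2) n.+3 (V1 x) (Z1 x))
  + (d ^+ 2 - D ^+ 2) * M n.+3 = (d - D) ^+ 2 * M n.+3 by rewrite /M; ring.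
by rewrite mulr_ge0 ?sqr_ge0// ltW.
Qed.

(** By [phi02E] the excess risk is a positive multiple of [d / D - 1 - ln (d / D)], nonnegative by
    [ln_leB1]. *)
Lemma generalized_Bayes_loss2 (R : realType) (n1 a1 b1 n2 a2 b2 n : nat) :
  (a1 <= b1)%N -> (a2 < b2)%N -> (b1 - a1 + (b2 - a2))%N = n.+2 ->
  generalized_Bayes (@prior R) (@likelihood R n1 a1 b1 n2 a2 b2) (@loss2 R)
    (fun x : data R => phi02 a1 b1 a2 b2 (Z1 x) * V1 x).
Proof.
move=> ab1 ab2 pqn; have ban := pqn; rewrite -subnDD ?(ltnW ab2)// in ban.
apply: generalized_Bayes_laurent pqn _ _ _ => //.
- have mid : measurable_fun setT (fun t : R => t) by exact: measurable_id.
  by rewrite /loss2; measurability; exact: measurable_ln.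
- by move=> t /loss2_bounds/andP[].
move=> x v0 v20; have u0 : 0 < Z1 x by rewrite divr_gt0.
have [_ p0 _] := phi_gt0 u0 ban; have := phi02E v0 u0 ban.
move: (_ * V1 x) (mulr_gt0 p0 v0) => D D0 ME M.
have M0 k : 0 < M k by exact: scale_moment_gt0.
split => //.
  exists (D^-1, 0, D, 0) => z z0.
  have /andP[_ /le_trans] := loss2_bounds (divr_gt0 D0 z0); apply.
  by rewrite invf_div /laurent/= addr0 mul0r addr0 addrC (mulrC z).
(* The terms in [ln z] cancel in the difference of losses and leave the constant [ln D - ln d]. *)
move=> d d0; exists (0, ln D - ln d, d - D, 0) => /=.
  by move=> z z0; rewrite /loss2 /laurent/= !ln_div ?posrE//; ring.
rewrite -[M n.+1]ME.
have -> : 0 * M n + (ln D - ln d) * (D * scale_moment (b2 - a2) n.+2 (V1 x) (Z1 x))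
  + (d - D) * M n.+2 + 0 * M n.+3 = D * ((d / D - 1) - (ln d - ln D)) * M n.+2.
  by rewrite /M; field; rewrite gt_eqF.
rewrite mulr_ge0 ?(ltW (M0 _))// mulr_ge0 ?(ltW D0)// subr_ge0 -ln_div ?posrE//.
by apply: ln_leB1; rewrite divr_gt0.
Qed.

(** By [phi03E] the excess risk is a positive multiple of [(d - D) ^+ 2 / d]. *)
Lemma generalized_Bayes_loss3 (R : realType) (n1 a1 b1 n2 a2 b2 n : nat) :
  (a1 <= b1)%N -> (a2 < b2)%N -> (b1 - a1 + (b2 - a2))%N = n.+2 ->
  generalized_Bayes (@prior R) (@likelihood R n1 a1 b1 n2 a2 b2) (@loss3 R)
    (fun x : data R => phi03 a1 b1 a2 b2 (Z1 x) * V1 x).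
Proof.
move=> ab1 ab2 pqn; have ban := pqn; rewrite -subnDD ?(ltnW ab2)// in ban.
apply: generalized_Bayes_laurent pqn _ _ _ => //.
- have mid : measurable_fun setT (fun t : R => t) by exact: measurable_id.
  by rewrite /loss3; measurability.
- exact: loss3_ge0.
move=> x v0 v20; have u0 : 0 < Z1 x by rewrite divr_gt0.
have [_ _ p0] := phi_gt0 u0 ban; have := phi03E v0 u0 ban.
move: (_ * V1 x) (mulr_gt0 p0 v0) => D D0 ME M.
have M0 k : 0 < M k by exact: scale_moment_gt0.
split => //.
  exists (D^-1, 0, D, 0) => z z0.
  rewrite /loss3 invf_div /laurent/= addr0 mul0r addr0 addrC (mulrC z); lra.
move=> d d0; exists (d^-1 - D^-1, 0, d - D, 0) => /=.
  by move=> z z0; rewrite /loss3 /laurent/= !invf_div; ring.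
rewrite -[M n]ME.
have -> : (d^-1 - D^-1) *
    (D ^+ 2 * scale_moment (b2 - a2) n.+2 (V1 x) (Z1 x)) + 0 * M n.+1
  + (d - D) * M n.+2 + 0 * M n.+3 = (d - D) ^+ 2 / d * M n.+2.
  by rewrite /M; field; rewrite !gt_eqF.
by rewrite mulr_ge0 ?(ltW (M0 _))// divr_ge0 ?sqr_ge0// ltW.
Qed.

Theorem mainTheorem7 (R : realType) (n1 a1 b1 n2 a2 b2 : nat)
    (ha1 : (1 <= a1)%N) (hab1 : (a1 < b1)%N) (hbn1 : (b1 <= n1)%N)
    (ha2 : (1 <= a2)%N) (hab2 : (a2 < b2)%N) (hbn2 : (b2 <= n2)%N) :
  [/\ generalized_Bayes (@prior R) (@likelihood R n1 a1 b1 n2 a2 b2) (@loss1 R)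
        (fun x : data R => phi01 a1 b1 a2 b2 (Z1 x) * V1 x),
      generalized_Bayes (@prior R) (@likelihood R n1 a1 b1 n2 a2 b2) (@loss2 R)
        (fun x : data R => phi02 a1 b1 a2 b2 (Z1 x) * V1 x) &
      generalized_Bayes (@prior R) (@likelihood R n1 a1 b1 n2 a2 b2) (@loss3 R)
        (fun x : data R => phi03 a1 b1 a2 b2 (Z1 x) * V1 x)].
Proof.
have ab1 := ltnW hab1.
(* Each sample contributes at least 1 to [b - a], so [b - a - 2] is a genuine natural number: the
   index of the moment [j = -1]. *)
have [n pqn] : exists n, (b1 - a1 + (b2 - a2))%N = n.+2.
  have p0 : (0 < b1 - a1)%N by rewrite subn_gt0.
  have q0 : (0 < b2 - a2)%N by rewrite subn_gt0.
  exists ((b1 - a1).-1 + (b2 - a2).-1)%N.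
  by rewrite -{1}(prednK p0) -{1}(prednK q0) addSn addnS.
split.
- exact: generalized_Bayes_loss1 pqn.
- exact: generalized_Bayes_loss2 pqn.
- exact: generalized_Bayes_loss3 pqn.
Qed.
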